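(* For every complex number $q$ with $|q|<1$, $$\sum_{n=0}^\infty \frac{q^{n(n+1)}(-q;q^2)_n}{(q;q)_{2n+1}} = \frac{f(1,q^2)}{2\psi(-q)} = (-q;q)_\infty(-q^2;q^2)_\infty .$$
   Context: Notation: $(a;q)_n=\prod_{j=0}^{n-1}(1-aq^j)$ (so $(a;q)_0=1$) and $(a;q)_\infty=\prod_{j=0}^\infty(1-aq^j)$; the base may be replaced by a power of $q$. Ramanujan's theta function is $f(a,b)=\sum_{n=-\infty}^\infty a^{n(n+1)/2}b^{n(n-1)/2}$ for $|ab|<1$ (with $0^0=1$), and $\psi(q)=f(q,q^3)$; $\psi(-q)$ is $\psi$ evaluated at $-q$. *)

(* Defs.v *)
From Stdlib Require Import Reals ZArith.
From Coquelicot Require Import Coquelicot.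

Open Scope C_scope.

Fixpoint qpoch (a q : C) (n : nat) : C :=
  match n with
  | O => 1
  | S m => qpoch a q m * (1 - a * q ^ m)
  end.

(* The limit of the finite products, which exists whenever |q| < 1. As with
   Coquelicot's [RInt], [iota] picks the unique value satisfying the predicate
   and is unspecified if there is none. *)
Definition qpoch_inf (a q : C) : C :=
  iota (T := C_CompleteNormedModule)
    (fun l : C => filterlim (qpoch a q) eventually (locally l)).

(* Convergence of a series indexed by Z: the sums over n >= 0 and over n < 0
   must converge separately. *)
Definition is_bilateral_series (u : Z -> C) (l : C) : Prop :=
  exists l1 l2 : C,
    is_series (V := C_NormedModule) (fun n : nat => u (Z.of_nat n)) l1 /\
    is_series (V := C_NormedModule) (fun n : nat => u (- Z.of_nat (S n))%Z) l2 /\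
    l = l1 + l2.

(* Both exponents are nonnegative integers for every n in Z, so neither the
   division nor [Z.to_nat] loses information; moreover [0 ^ 0 = 1] for [Cpow]. *)
Definition theta_term (a b : C) (n : Z) : C :=
  a ^ Z.to_nat (n * (n + 1) / 2) * b ^ Z.to_nat (n * (n - 1) / 2).

(* Ramanujan's f(a,b); meaningful for |ab| < 1, where the series converges. *)
Definition theta (a b : C) : C :=
  iota (T := C_CompleteNormedModule) (is_bilateral_series (theta_term a b)).

Definition psi (q : C) : C := theta q (q ^ 3).

(* Main.v *)
Require Import Defs.
From Stdlib Require Import Reals ZArith Lra Lia.
From Coquelicot Require Import Coquelicot.

Open Scope C_scope.

(** Both sides equal [(-q^2;q^2)_oo / (q;q^2)_oo].

    For the series, the split
    [(q;q)_(2n+1) = (1-q) (q^3;q^2)_n (q^2;q^2)_n] turns it into [1/(1-q)] times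
    a series in base [Q = q^2] of the shape
    [sum_n (a;Q)_n (-z)^n Q^(n(n-1)/2) / ((Q;Q)_n (az;Q)_n)], with [a = -q] and
    [z = -q^2] ([main_summand]).  This is the limit [b -> oo] of Heine's q-Gauss
    sum, and its value is [(z;Q)_oo / (az;Q)_oo] ([q_gauss_limit]).  The reason is
    a contiguity relation: if [F(z)] denotes the sum, then
    [(1-az) F(z) = (1-z) F(zQ)], because the difference of the two series
    telescopes ([gauss_term_recurrence]).  Iterating pushes [z] to [0],
    where [F] is [1], and the factors collected on the way are the two infinite
    products.

    For the quotient of theta functions, [psi(q)] is a rearrangement of the sum of
    [q^(s(s+1)/2)] over [s >= 0] and [f(1,q)] is twice that sum, which by Gauss
    equals [(q^2;q^2)_oo / (q;q^2)_oo] ([gauss_triangular]).  Gauss's identity is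
    the limit of a finite identity of Shanks ([shanks_identity]).  Applying it at
    [q^2] and at [-q] and cancelling with [(a;q)_oo (-a;q)_oo = (a^2;q^2)_oo]
    gives the same quotient ([theta_quotient]).

    Finally Euler's [(-q;q)_oo (q;q^2)_oo = 1] ([euler_odd_distinct]) removes the
    denominator. *)

(** * Limits of complex sequences *)

Definition Clim (u : nat -> C) (l : C) : Prop :=
  filterlim u eventually (locally (T := C_UniformSpace) l).

Lemma Clim_unique u l l' : Clim u l -> Clim u l' -> l = l'.
Proof.
  intros H H'.
  exact (filterlim_locally_unique (V := C_NormedModule) u l l' H H').
Qed.

Lemma Clim_ext u v l : (forall n, u n = v n) -> Clim u l -> Clim v l.
Proof. apply filterlim_ext. Qed.

Lemma Clim_const c : Clim (fun _ => c) c.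
Proof. apply filterlim_const. Qed.

Lemma Clim_plus u v l m :
  Clim u l -> Clim v m -> Clim (fun n => u n + v n) (l + m).
Proof.
  intros Hu Hv.
  exact (filterlim_comp_2 _ _ _ Hu Hv
           (filterlim_plus (V := C_NormedModule) l m)).
Qed.

Lemma Clim_mult u v l m :
  Clim u l -> Clim v m -> Clim (fun n => u n * v n) (l * m).
Proof.
  intros Hu Hv.
  (* Continuity of multiplication is stated for the uniformity of the modulus;
     [locally_C] gives the same neighbourhoods as in the product of two lines. *)
  assert (Hu' : filterlim u eventually (locally (T := AbsRing_UniformSpace C_AbsRing) l)).
  { intros P HP. apply Hu. now apply locally_C. }
  exact (filterlim_comp_2 _ _ _ Hu' Hv
           (filterlim_scal (V := C_NormedModule) l m)).
Qed.

Lemma Clim_subseq u l (phi : nat -> nat) :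
  (forall n, (n <= phi n)%nat) -> Clim u l -> Clim (fun n => u (phi n)) l.
Proof.
  intros Hphi H P HP. destruct (H P HP) as [N HN].
  exists N. intros n Hn. apply HN. specialize (Hphi n). lia.
Qed.

Lemma Clim_squeeze u l (v : nat -> R) :
  (forall n, (Cmod (u n - l) <= v n)%R) -> is_lim_seq v 0 -> Clim u l.
Proof.
  intros Hle Hv. apply filterlim_locally. intros eps.
  assert (H : eventually (fun n => ball 0%R eps (v n))).
  { apply Hv. apply locally_ball. }
  destruct H as [N HN]. exists N. intros n Hn.
  apply C_NormedModule_mixin_compat1.
  apply Rle_lt_trans with (1 := Hle n).
  apply Rle_lt_trans with (1 := Rle_abs (v n)).
  generalize (HN n Hn). unfold ball; simpl. unfold AbsRing_ball; simpl.
  unfold abs, minus, plus, opp; simpl.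
  now rewrite Ropp_0, Rplus_0_r.
Qed.

Lemma Clim_Cmod u l : Clim u l -> is_lim_seq (fun n => Cmod (u n)) (Cmod l).
Proof.
  intros H.
  exact (filterlim_comp _ _ _ u _ _ _ _ H (filterlim_norm (V := C_NormedModule) l)).
Qed.

Lemma Clim_Cmod_le u l c (K : R) :
  Clim u l -> (forall n, (Cmod (u n - c) <= K)%R) -> (Cmod (l - c) <= K)%R.
Proof.
  intros Hu HK.
  exact (is_lim_seq_le (fun n => Cmod (u n - c)) (fun _ => K) (Cmod (l - c)) K HK
           (Clim_Cmod _ _ (Clim_plus _ _ _ _ Hu (Clim_const (- c))))
           (is_lim_seq_const K)).
Qed.

Lemma Clim_Cmod_ge u l (c : R) :
  Clim u l -> (forall n, (c <= Cmod (u n))%R) -> (c <= Cmod l)%R.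
Proof.
  intros Hu Hc.
  exact (is_lim_seq_le (fun _ => c) (fun n => Cmod (u n)) c (Cmod l) Hc
           (is_lim_seq_const c) (Clim_Cmod _ _ Hu)).
Qed.

Lemma is_lim_seq_scal_pow (K r : R) :
  (0 <= r < 1)%R -> is_lim_seq (fun n => (K * r ^ n)%R) 0.
Proof.
  intros Hr. replace (Finite 0) with (Rbar_mult K 0) by (simpl; f_equal; ring).
  apply is_lim_seq_scal_l, is_lim_seq_geom. rewrite Rabs_pos_eq; lra.
Qed.

Lemma is_series_cons (a : nat -> C) (l : C) :
  is_series (V := C_NormedModule) (fun n => a (S n)) l ->
  is_series (V := C_NormedModule) a (a 0%nat + l).
Proof.
  intros H. apply (is_series_decr_1 (V := C_NormedModule) a).
  replace (plus _ _) with l; [exact H|].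
  change (l = a 0%nat + l + - a 0%nat). ring.
Qed.

Lemma is_series_behead (a : nat -> C) (l : C) :
  is_series (V := C_NormedModule) a l ->
  is_series (V := C_NormedModule) (fun n => a (S n)) (l - a 0%nat).
Proof.
  intros H. apply (is_series_incr_1 (V := C_NormedModule) a).
  replace (plus _ _) with l; [exact H|].
  change (l = l - a 0%nat + a 0%nat). ring.
Qed.

Lemma is_series_lim_0 (a : nat -> C) (l : C) :
  is_series (V := C_NormedModule) a l -> Clim (fun n => a (S n)) 0.
Proof.
  intros H. replace (RtoC 0) with (l + (- (1)) * l) by ring.
  apply Clim_ext with
    (fun n => sum_n (G := C_AbelianMonoid) a (S n) + (- (1)) * sum_n (G := C_AbelianMonoid) a n).
  { intros n. rewrite sum_Sn. change plus with Cplus. ring. }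
  apply Clim_plus.
  - apply (Clim_subseq _ _ S); [lia | exact H].
  - apply Clim_mult; [apply Clim_const | exact H].
Qed.

(** * Finite and infinite q-products *)

Lemma one_minus_neq_0 (x : C) : (Cmod x < 1)%R -> 1 - x <> 0.
Proof.
  intros H E. replace x with (RtoC 1) in H.
  - rewrite Cmod_1 in H. lra.
  - replace (RtoC 1) with (1 - x + x) by ring. rewrite E. ring.
Qed.

Lemma Cmod_pow_le_1 (q : C) n : (Cmod q < 1)%R -> (Cmod (q ^ n) <= 1)%R.
Proof.
  intros H. rewrite Cmod_pow. rewrite <- (pow1 n).
  apply pow_incr. split; [apply Cmod_ge_0 | lra].
Qed.

Lemma Cmod_pow_S_lt_1 (q : C) n : (Cmod q < 1)%R -> (Cmod (q ^ S n) < 1)%R.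
Proof.
  intros H. rewrite Cpow_S, Cmod_mult.
  generalize (Cmod_pow_le_1 q n H) (Cmod_ge_0 q) (Cmod_ge_0 (q ^ n)). nra.
Qed.

Lemma qpoch_S a q n : qpoch a q (S n) = qpoch a q n * (1 - a * q ^ n).
Proof. reflexivity. Qed.

Lemma qpoch_add a q m n : qpoch a q (m + n) = qpoch a q m * qpoch (a * q ^ m) q n.
Proof.
  induction n as [|n IH].
  - rewrite Nat.add_0_r. simpl. ring.
  - rewrite Nat.add_succ_r. simpl. rewrite IH, Cpow_add_r. ring.
Qed.

Lemma qpoch_S_l a q n : qpoch a q (S n) = (1 - a) * qpoch (a * q) q n.
Proof.
  change (S n) with (1 + n)%nat. rewrite qpoch_add. simpl.
  rewrite !Cmult_1_r, Cmult_1_l. reflexivity.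
Qed.

Lemma qpoch_neq_0 a q n : (forall k, 1 - a * q ^ k <> 0) -> qpoch a q n <> 0.
Proof.
  intros H. induction n as [|n IH]; simpl.
  - intros E. injection E. lra.
  - now apply Cmult_neq_0.
Qed.

Lemma qpoch_even_odd q n :
  qpoch q q (2 * n) = qpoch q (q ^ 2) n * qpoch (q ^ 2) (q ^ 2) n.
Proof.
  induction n as [|n IH]; [simpl; ring|].
  replace (2 * S n)%nat with (S (S (2 * n))) by lia.
  rewrite !qpoch_S, IH, (Cpow_S _ (2 * n)), !Cpow_mult_r. ring.
Qed.

Lemma partial_geom_le (a r : R) n :
  (0 <= a)%R -> (0 <= r < 1)%R -> (a * (1 - r ^ n) / (1 - r) <= a / (1 - r))%R.
Proof.
  intros Ha Hr. unfold Rdiv. apply Rmult_le_compat_r.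
  - apply Rlt_le, Rinv_0_lt_compat. lra.
  - generalize (pow_le r n (proj1 Hr)). nra.
Qed.

(** From [1 + x <= exp x]: the exponents form a geometric sum. *)
Lemma qpoch_upper a q :
  (Cmod q < 1)%R ->
  forall n, (Cmod (qpoch a q n) <= exp (Cmod a / (1 - Cmod q)))%R.
Proof.
  intros Hq n.
  apply Rle_trans with (exp (Cmod a * (1 - Cmod q ^ n) / (1 - Cmod q)))%R.
  - induction n as [|n IH]; simpl.
    + rewrite Cmod_1. replace (Cmod a * (1 - 1) / (1 - Cmod q))%R with 0%R by (field; lra).
      rewrite exp_0. lra.
    + rewrite Cmod_mult.
      replace (Cmod a * (1 - Cmod q * Cmod q ^ n) / (1 - Cmod q))%R
        with (Cmod a * (1 - Cmod q ^ n) / (1 - Cmod q) + Cmod a * Cmod q ^ n)%R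
        by (field; lra).
      rewrite exp_plus.
      apply Rmult_le_compat; try apply Cmod_ge_0; [exact IH|].
      apply Rle_trans with (1 + Cmod a * Cmod q ^ n)%R; [|apply exp_ineq1_le].
      unfold Cminus. apply Rle_trans with (1 := Cmod_triangle _ _).
      rewrite Cmod_opp, Cmod_1, Cmod_mult, Cmod_pow. lra.
  - assert (Hm := partial_geom_le (Cmod a) (Cmod q) n (Cmod_ge_0 a) (conj (Cmod_ge_0 q) Hq)).
    destruct Hm as [Hm|Hm]; [left; now apply exp_increasing | right; now rewrite Hm].
Qed.

(** The successive differences of the products are dominated by a geometric
    series, since the products stay bounded. *)
Lemma qpoch_converges a q : (Cmod q < 1)%R -> exists l, Clim (qpoch a q) l.
Proof.
  intros Hq. set (B := exp (Cmod a / (1 - Cmod q))).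
  assert (Hex : ex_series (V := C_CompleteNormedModule)
                  (fun n => qpoch a q (S n) - qpoch a q n)).
  { apply (ex_series_le (V := C_CompleteNormedModule)) with
      (b := fun n => (B * Cmod a * Cmod q ^ n)%R).
    - intros n. change norm with Cmod. simpl.
      replace (qpoch a q n * (1 - a * q ^ n) - qpoch a q n)
        with (- (qpoch a q n * (a * q ^ n))) by ring.
      rewrite Cmod_opp, !Cmod_mult, Cmod_pow, <- Rmult_assoc.
      apply Rmult_le_compat_r; [apply pow_le, Cmod_ge_0|].
      apply Rmult_le_compat_r; [apply Cmod_ge_0|]. now apply qpoch_upper.
    - apply (ex_series_scal_l (V := R_NormedModule) (B * Cmod a)%R).
      apply ex_series_geom. rewrite Rabs_pos_eq; [exact Hq | apply Cmod_ge_0]. }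
  destruct Hex as [l Hl]. exists (1 + l).
  assert (Hs : Clim (fun n => qpoch a q (S n)) (1 + l)).
  { apply Clim_ext with
      (fun n => 1 + sum_n (G := C_AbelianMonoid) (fun n => qpoch a q (S n) - qpoch a q n) n).
    - induction n as [|n IH].
      + rewrite sum_O. simpl. ring.
      + rewrite sum_Sn. change plus with Cplus. rewrite Cplus_assoc, IH. ring.
    - apply Clim_plus; [apply Clim_const | exact Hl]. }
  intros P HP. destruct (Hs P HP) as [N HN]. exists (S N).
  intros [|n] Hn; [lia|]. apply HN. lia.
Qed.

Lemma qpoch_inf_correct a q : (Cmod q < 1)%R -> Clim (qpoch a q) (qpoch_inf a q).
Proof.
  intros Hq. destruct (qpoch_converges a q Hq) as [l Hl].
  replace (qpoch_inf a q) with l; [exact Hl|]. symmetry.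
  exact (iota_filterlim_locally (V := C_CompleteNormedModule) (qpoch a q) l Hl).
Qed.

(** Weierstrass's inequality: a product of factors [1 - u_j] has modulus at least
    [1 - sum |u_j|]. *)
Lemma qpoch_lower_small a q :
  (Cmod q < 1)%R -> (Cmod a / (1 - Cmod q) <= / 2)%R ->
  forall n, (/ 2 <= Cmod (qpoch a q n))%R.
Proof.
  intros Hq Ha n.
  assert (Ha' : (2 * Cmod a <= 1 - Cmod q)%R).
  { apply (Rmult_le_compat_r (1 - Cmod q)) in Ha; [|lra].
    unfold Rdiv in Ha. rewrite Rmult_assoc, Rinv_l in Ha; lra. }
  assert (Hw : (1 - Cmod a * (1 - Cmod q ^ n) / (1 - Cmod q) <= Cmod (qpoch a q n))%R).
  { induction n as [|n IH]; simpl.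
    - rewrite Cmod_1. right. field. lra.
    - rewrite Cmod_mult.
      assert (Hf : (1 - Cmod a * Cmod q ^ n <= Cmod (1 - a * q ^ n))%R).
      { generalize (Cmod_triangle (1 - a * q ^ n) (a * q ^ n)).
        replace (1 - a * q ^ n + a * q ^ n) with (RtoC 1) by ring.
        rewrite Cmod_1, Cmod_mult, Cmod_pow. lra. }
      replace (1 - Cmod a * (1 - Cmod q * Cmod q ^ n) / (1 - Cmod q))%R
        with (1 - Cmod a * (1 - Cmod q ^ n) / (1 - Cmod q) - Cmod a * Cmod q ^ n)%R
        by (field; lra).
      assert (H0 : (0 <= Cmod a * (1 - Cmod q ^ n) / (1 - Cmod q))%R).
      { generalize (Cmod_pow_le_1 q n Hq). rewrite Cmod_pow. intros Hp.
        apply Rmult_le_pos; [|left; apply Rinv_0_lt_compat; lra].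
        apply Rmult_le_pos; [apply Cmod_ge_0 | lra]. }
      assert (H1 : (0 <= Cmod a * Cmod q ^ n <= 1)%R).
      { generalize (Cmod_pow_le_1 q n Hq) (Cmod_ge_0 a) (Cmod_ge_0 q)
          (pow_le (Cmod q) n (Cmod_ge_0 q)). rewrite Cmod_pow. nra. }
      set (s := (Cmod a * (1 - Cmod q ^ n) / (1 - Cmod q))%R) in *.
      set (t := (Cmod a * Cmod q ^ n)%R) in *.
      generalize (Cmod_ge_0 (qpoch a q n)). nra. }
  apply Rle_trans with (2 := Hw).
  generalize (partial_geom_le (Cmod a) (Cmod q) n (Cmod_ge_0 a) (conj (Cmod_ge_0 q) Hq)). lra.
Qed.

(** Beyond some index the factors satisfy the smallness condition of
    [qpoch_lower_small]; the finitely many products before it are nonzero. *)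
Lemma qpoch_lower a q :
  (Cmod q < 1)%R -> (forall k, 1 - a * q ^ k <> 0) ->
  exists c : R, (0 < c)%R /\ forall n, (c <= Cmod (qpoch a q n))%R.
Proof.
  intros Hq Hnz.
  assert (Hm : exists m, (Cmod (a * q ^ m) / (1 - Cmod q) <= / 2)%R).
  { assert (Hl : is_lim_seq (fun n => (Cmod a / (1 - Cmod q) * Cmod q ^ n)%R) 0).
    { apply is_lim_seq_scal_pow. split; [apply Cmod_ge_0 | exact Hq]. }
    assert (Hpos : (0 < / 2)%R) by lra.
    apply is_lim_seq_spec in Hl. destruct (Hl (mkposreal _ Hpos)) as [m Hm].
    exists m. specialize (Hm m (le_n m)). simpl in Hm.
    rewrite Rminus_0_r in Hm. apply Rle_trans with (2 := Rlt_le _ _ Hm).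
    apply Rle_trans with (2 := Rle_abs _). rewrite Cmod_mult, Cmod_pow.
    right. field. lra. }
  destruct Hm as [m Hm].
  assert (Htail : forall n, (m <= n)%nat -> (Cmod (qpoch a q m) * / 2 <= Cmod (qpoch a q n))%R).
  { intros n Hn. replace n with (m + (n - m))%nat by lia.
    rewrite qpoch_add, Cmod_mult. apply Rmult_le_compat_l; [apply Cmod_ge_0|].
    now apply qpoch_lower_small. }
  assert (Hhead : forall N, exists c : R, (0 < c)%R /\
            forall n, (n < N)%nat -> (c <= Cmod (qpoch a q n))%R).
  { induction N as [|N [c [Hc HN]]].
    - exists 1%R. split; [lra | intros n Hn; lia].
    - exists (Rmin c (Cmod (qpoch a q N))). split.
      + apply Rmin_glb_lt; [exact Hc|]. now apply Cmod_gt_0, qpoch_neq_0.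
      + intros n Hn. destruct (Nat.eq_dec n N) as [->|Hne]; [apply Rmin_r|].
        apply Rle_trans with (1 := Rmin_l _ _). apply HN. lia. }
  destruct (Hhead m) as [c [Hc Hcm]].
  exists (Rmin c (Cmod (qpoch a q m) * / 2)). split.
  - apply Rmin_glb_lt; [exact Hc|].
    assert (0 < Cmod (qpoch a q m))%R by now apply Cmod_gt_0, qpoch_neq_0. lra.
  - intros n. destruct (Nat.lt_ge_cases n m) as [Hn|Hn].
    + apply Rle_trans with (1 := Rmin_l _ _). now apply Hcm.
    + apply Rle_trans with (1 := Rmin_r _ _). now apply Htail.
Qed.

Lemma qpoch_inf_neq_0 a q :
  (Cmod q < 1)%R -> (forall k, 1 - a * q ^ k <> 0) -> qpoch_inf a q <> 0.
Proof.
  intros Hq Hnz. destruct (qpoch_lower a q Hq Hnz) as [c [Hc Hle]].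
  apply Cmod_gt_0. apply Rlt_le_trans with (1 := Hc).
  exact (Clim_Cmod_ge _ _ _ (qpoch_inf_correct a q Hq) Hle).
Qed.

Lemma qpoch_q_factor_neq_0 q : (Cmod q < 1)%R -> forall k, 1 - q * q ^ k <> 0.
Proof. intros Hq k. rewrite <- Cpow_S. now apply one_minus_neq_0, Cmod_pow_S_lt_1. Qed.

Lemma Cmod_pow_2_lt_1 q : (Cmod q < 1)%R -> (Cmod (q ^ 2) < 1)%R.
Proof. apply Cmod_pow_S_lt_1. Qed.

Lemma qpoch_odd_factor_neq_0 q : (Cmod q < 1)%R -> forall k, 1 - q * (q ^ 2) ^ k <> 0.
Proof.
  intros Hq k. rewrite <- Cpow_mult_r, <- Cpow_S.
  now apply one_minus_neq_0, Cmod_pow_S_lt_1.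
Qed.

Lemma qpoch_even_neq_0 q n : (Cmod q < 1)%R -> qpoch (q ^ 2) (q ^ 2) n <> 0.
Proof. intros Hq. now apply qpoch_neq_0, qpoch_q_factor_neq_0, Cmod_pow_2_lt_1. Qed.

Lemma qpoch_inf_S_l a q :
  (Cmod q < 1)%R -> qpoch_inf a q = (1 - a) * qpoch_inf (a * q) q.
Proof.
  intros Hq. apply Clim_unique with (fun n => qpoch a q (S n)).
  - apply (Clim_subseq _ _ S); [lia | now apply qpoch_inf_correct].
  - apply Clim_ext with (fun n => (1 - a) * qpoch (a * q) q n).
    { intros n. now rewrite qpoch_S_l. }
    apply Clim_mult; [apply Clim_const | now apply qpoch_inf_correct].
Qed.

Lemma qpoch_inf_even_odd q :
  (Cmod q < 1)%R -> qpoch_inf q q = qpoch_inf q (q ^ 2) * qpoch_inf (q ^ 2) (q ^ 2).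
Proof.
  intros Hq. assert (Hq2 := Cmod_pow_2_lt_1 q Hq).
  apply Clim_unique with (fun n => qpoch q q (2 * n)).
  - apply (Clim_subseq _ _ (fun n => (2 * n)%nat)); [lia | now apply qpoch_inf_correct].
  - apply Clim_ext with (fun n => qpoch q (q ^ 2) n * qpoch (q ^ 2) (q ^ 2) n).
    + intros n. symmetry. apply qpoch_even_odd.
    + apply Clim_mult; now apply qpoch_inf_correct.
Qed.

Lemma qpoch_inf_mult_opp a q :
  (Cmod q < 1)%R -> qpoch_inf a q * qpoch_inf (- a) q = qpoch_inf (a ^ 2) (q ^ 2).
Proof.
  intros Hq. assert (Hq2 := Cmod_pow_2_lt_1 q Hq).
  apply Clim_unique with (fun n => qpoch a q n * qpoch (- a) q n).
  - apply Clim_mult; now apply qpoch_inf_correct.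
  - apply Clim_ext with (qpoch (a ^ 2) (q ^ 2)); [|now apply qpoch_inf_correct].
    induction n as [|n IH]; [simpl; ring|].
    rewrite !qpoch_S, IH, <- Cpow_mult_r, Nat.mul_comm, Cpow_mult_r. ring.
Qed.

(** Euler's theorem on partitions into distinct parts and into odd parts: in
    [(q;q)_oo (-q;q)_oo = (q^2;q^2)_oo], the even factors of [(q;q)_oo] cancel. *)
Lemma euler_odd_distinct q :
  (Cmod q < 1)%R -> qpoch_inf (- q) q * qpoch_inf q (q ^ 2) = 1.
Proof.
  intros Hq. assert (Hq2 := Cmod_pow_2_lt_1 q Hq).
  assert (H := qpoch_inf_mult_opp q q Hq). rewrite qpoch_inf_even_odd in H by exact Hq.
  assert (Hnz : qpoch_inf (q ^ 2) (q ^ 2) <> 0)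
    by now apply qpoch_inf_neq_0, qpoch_q_factor_neq_0.
  transitivity (qpoch_inf q (q ^ 2) * qpoch_inf (q ^ 2) (q ^ 2) * qpoch_inf (- q) q
                / qpoch_inf (q ^ 2) (q ^ 2)).
  - field. exact Hnz.
  - rewrite H. field. exact Hnz.
Qed.

(** * Triangular numbers *)

Lemma triangle_S n : (S n * (S n + 1) / 2 = n * (n + 1) / 2 + S n)%nat.
Proof.
  rewrite <- Nat.div_add by lia. f_equal. lia.
Qed.

Lemma triangle_double n : (2 * (n * (n + 1) / 2) = n * (n + 1))%nat.
Proof.
  induction n as [|n IH]; [reflexivity|]. rewrite triangle_S. lia.
Qed.

Lemma triangle_even n : (S (2 * n) * (S (2 * n) + 1) / 2 = S n * S (2 * n))%nat.
Proof.
  replace (S (2 * n) * (S (2 * n) + 1))%nat with (S n * S (2 * n) * 2)%nat by lia.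
  apply Nat.div_mul. lia.
Qed.

Lemma triangle_odd n : (2 * n * (2 * n + 1) / 2 = n * S (2 * n))%nat.
Proof.
  replace (2 * n * (2 * n + 1))%nat with (n * S (2 * n) * 2)%nat by lia.
  apply Nat.div_mul. lia.
Qed.

Lemma choose_two_S n : (S n * (S n - 1) / 2 = n * (n - 1) / 2 + n)%nat.
Proof.
  rewrite <- Nat.div_add by lia. f_equal. destruct n; simpl; lia.
Qed.

(** * The limiting case of the q-Gauss sum *)

(** The summand of Heine's [2phi1(a,b;az;q,z/b)] in the limit [b -> oo]. *)
Definition gauss_term (a z q : C) (n : nat) : C :=
  qpoch a q n * (- z) ^ n * q ^ (n * (n - 1) / 2) / (qpoch q q n * qpoch (a * z) q n).

(** The certificate for the contiguity relation.  With [T] for the summand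
    and [q^n = 1 - (1-q^n)], it says that [(1-az) T_n(z) - (1-z) T_n(zq)] is
    [G_(n+1) - G_n] for [G_n = -(1-az)(1-q^n) T_n(z)]. *)
Lemma gauss_term_recurrence a z q n :
  (Cmod q < 1)%R -> (forall k, 1 - a * z * q ^ k <> 0) ->
  (1 - a * z) * q ^ n * gauss_term a z q n
  = (1 - z) * gauss_term a (z * q) q n
    - (1 - a * z) * (1 - q ^ S n) * gauss_term a z q (S n).
Proof.
  intros Hq Haz. unfold gauss_term.
  assert (H0 : 1 - a * z <> 0).
  { generalize (Haz 0%nat). simpl. now rewrite Cmult_1_r. }
  assert (Hs : qpoch (a * (z * q)) q n = qpoch (a * z) q n * (1 - a * z * q ^ n) / (1 - a * z)).
  { change (qpoch (a * z) q n * (1 - a * z * q ^ n)) with (qpoch (a * z) q (S n)).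
    rewrite qpoch_S_l, (Cmult_assoc a). field. exact H0. }
  rewrite Hs, choose_two_S, Cpow_add_r. simpl qpoch.
  replace (- (z * q)) with (- z * q) by ring. rewrite Cpow_mult_l, !Cpow_S.
  generalize (Haz n) (qpoch_neq_0 _ q n Haz) (qpoch_q_factor_neq_0 q Hq n)
    (qpoch_neq_0 _ q n (qpoch_q_factor_neq_0 q Hq)).
  intros. field. repeat split; assumption.
Qed.

Lemma gauss_sum_recurrence a z q n :
  (Cmod q < 1)%R -> (forall k, 1 - a * z * q ^ k <> 0) ->
  (1 - a * z) * sum_n (G := C_AbelianMonoid) (gauss_term a z q) n
  = (1 - z) * sum_n (G := C_AbelianMonoid) (gauss_term a (z * q) q) n
    - (1 - a * z) * (1 - q ^ S n) * gauss_term a z q (S n).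
Proof.
  intros Hq Haz. induction n as [|n IH].
  - rewrite !sum_O. rewrite <- gauss_term_recurrence by assumption. simpl. ring.
  - rewrite !sum_Sn. change plus with Cplus.
    rewrite !Cmult_plus_distr_l, IH.
    generalize (gauss_term_recurrence a z q (S n) Hq Haz). intros E.
    transitivity ((1 - z) * sum_n (G := C_AbelianMonoid) (gauss_term a (z * q) q) n
      + (1 - a * z) * q ^ S n * gauss_term a z q (S n)); [ring|].
    rewrite E. ring.
Qed.

(** The bound is uniform in [k], which is what allows [k -> oo] under the sum: as
    [(azq^k;q)_n = (az;q)_(k+n) / (az;q)_k], all shifted denominators are
    controlled by the products at [az]. *)
Lemma gauss_term_bound a z q :
  (Cmod q < 1)%R -> (forall k, 1 - a * z * q ^ k <> 0) ->
  exists M : R, (0 <= M)%R /\ forall k n,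
    (Cmod (gauss_term a (z * q ^ k) q n) <= M * (Cmod z * Cmod q ^ k) ^ n)%R.
Proof.
  intros Hq Haz.
  destruct (qpoch_lower q q Hq (qpoch_q_factor_neq_0 q Hq)) as [c [Hc Hqn]].
  destruct (qpoch_lower (a * z) q Hq Haz) as [d [Hd Hazn]].
  generalize (qpoch_upper a q Hq) (qpoch_upper (a * z) q Hq).
  set (A := exp (Cmod a / (1 - Cmod q))). set (B := exp (Cmod (a * z) / (1 - Cmod q))).
  intros HA HB.
  assert (HA0 : (0 < A)%R) by apply exp_pos. assert (HB0 : (0 < B)%R) by apply exp_pos.
  assert (Hcd : (0 < c * d)%R) by now apply Rmult_lt_0_compat.
  exists (A * B / (c * d))%R. split.
  { apply Rlt_le, Rdiv_lt_0_compat; [now apply Rmult_lt_0_compat | exact Hcd]. }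
  intros k n. unfold gauss_term.
  set (P := qpoch (a * (z * q ^ k)) q n).
  assert (HP : (d <= B * Cmod P)%R).
  { apply Rle_trans with (1 := Hazn (k + n)%nat). rewrite qpoch_add, Cmod_mult.
    replace (a * z * q ^ k) with (a * (z * q ^ k)) by ring. fold P.
    apply Rmult_le_compat_r; [apply Cmod_ge_0 | apply HB]. }
  assert (HP0 : (0 < Cmod P)%R).
  { generalize (Cmod_ge_0 P). nra. }
  assert (HQ0 : (0 < Cmod (qpoch q q n))%R) by (generalize (Hqn n); lra).
  rewrite Cmod_div.
  2:{ apply Cmult_neq_0; now apply Cmod_gt_0. }
  rewrite !Cmod_mult. rewrite (Cmod_pow (- _)), Cmod_opp, Cmod_mult, (Cmod_pow q k).
  set (w := ((Cmod z * Cmod q ^ k) ^ n)%R).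
  assert (Hw : (0 <= w)%R).
  { apply pow_le, Rmult_le_pos; [apply Cmod_ge_0 | apply pow_le, Cmod_ge_0]. }
  generalize (Cmod_pow_le_1 q (n * (n - 1) / 2) Hq) (Cmod_ge_0 (q ^ (n * (n - 1) / 2))).
  set (e := Cmod (q ^ (n * (n - 1) / 2))). intros He1 He0.
  assert (HN : (Cmod (qpoch a q n) * w * e <= A * w)%R).
  { rewrite <- (Rmult_1_r (A * w)). apply Rmult_le_compat; try assumption.
    - apply Rmult_le_pos; [apply Cmod_ge_0 | exact Hw].
    - apply Rmult_le_compat_r; [exact Hw | apply HA]. }
  assert (HD : (c * d / B <= Cmod (qpoch q q n) * Cmod P)%R).
  { unfold Rdiv. rewrite Rmult_assoc. apply Rmult_le_compat; try lra.
    - apply Rlt_le, Rdiv_lt_0_compat; assumption.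
    - apply Hqn.
    - apply (Rmult_le_reg_l B); [exact HB0|].
      replace (B * (d * / B))%R with d by (field; lra). exact HP. }
  replace (A * B / (c * d) * w)%R with (A * w * / (c * d / B))%R by (field; lra).
  apply Rmult_le_compat; try assumption.
  - repeat apply Rmult_le_pos; try assumption; apply Cmod_ge_0.
  - apply Rlt_le, Rinv_0_lt_compat. now apply Rmult_lt_0_compat.
  - apply Rinv_le_contravar; [|exact HD]. now apply Rdiv_lt_0_compat.
Qed.

Lemma gauss_series_converges a z q :
  (Cmod q < 1)%R -> (Cmod z < 1)%R -> (forall k, 1 - a * z * q ^ k <> 0) ->
  exists l : C, is_series (V := C_NormedModule) (gauss_term a z q) l.
Proof.
  intros Hq Hz Haz. destruct (gauss_term_bound a z q Hq Haz) as [M [HM Hb]].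
  apply (ex_series_le (V := C_CompleteNormedModule)) with (b := fun n => (M * Cmod z ^ n)%R).
  - intros n. change norm with Cmod. generalize (Hb 0%nat n). simpl.
    now rewrite Cmult_1_r, Rmult_1_r.
  - apply (ex_series_scal_l (V := R_NormedModule) M).
    apply ex_series_geom. rewrite Rabs_pos_eq; [exact Hz | apply Cmod_ge_0].
Qed.

(** The boundary term of the telescoping sum vanishes because the terms of a
    convergent series do. *)
Lemma gauss_series_shift a z q l l' :
  (Cmod q < 1)%R -> (forall k, 1 - a * z * q ^ k <> 0) ->
  is_series (V := C_NormedModule) (gauss_term a z q) l ->
  is_series (V := C_NormedModule) (gauss_term a (z * q) q) l' ->
  (1 - a * z) * l = (1 - z) * l'.
Proof.
  intros Hq Haz Hl Hl'.
  assert (H0 : Clim (fun n => (1 - q ^ S n) * gauss_term a z q (S n)) 0).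
  { replace (RtoC 0) with ((1 - 0) * 0) by ring.
    apply Clim_mult; [|exact (is_series_lim_0 _ _ Hl)].
    apply Clim_squeeze with (fun n => (1 * Cmod q ^ n)%R).
    - intros n. replace (1 - q ^ S n - (1 - 0)) with (- (q ^ S n)) by ring.
      rewrite Cmod_opp, Cmod_pow. simpl.
      apply Rmult_le_compat_r; [apply pow_le, Cmod_ge_0 | lra].
    - apply is_lim_seq_scal_pow. split; [apply Cmod_ge_0 | exact Hq]. }
  replace ((1 - z) * l') with ((1 - z) * l' + - (1 - a * z) * 0) by ring.
  apply Clim_unique with (fun n => (1 - a * z) * sum_n (G := C_AbelianMonoid) (gauss_term a z q) n).
  - apply Clim_mult; [apply Clim_const | exact Hl].
  - apply Clim_ext with (fun n => (1 - z) * sum_n (G := C_AbelianMonoid) (gauss_term a (z * q) q) n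
      + - (1 - a * z) * ((1 - q ^ S n) * gauss_term a z q (S n))).
    { intros n. rewrite gauss_sum_recurrence by assumption. ring. }
    apply Clim_plus.
    + apply Clim_mult; [apply Clim_const | exact Hl'].
    + apply Clim_mult; [apply Clim_const | exact H0].
Qed.

(** The bound of [gauss_term_bound] summed over [n >= 1], where it gains at least
    one factor [q^k]. *)
Lemma gauss_series_near_1 a z q :
  (Cmod q < 1)%R -> (Cmod z < 1)%R -> (forall k, 1 - a * z * q ^ k <> 0) ->
  exists K : R, forall k (l : C),
    is_series (V := C_NormedModule) (gauss_term a (z * q ^ k) q) l ->
    (Cmod (l - 1) <= K * Cmod q ^ k)%R.
Proof.
  intros Hq Hz Haz. destruct (gauss_term_bound a z q Hq Haz) as [M [HM Hb]].
  exists (M / (1 - Cmod z))%R. intros k l Hl.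
  apply (Clim_Cmod_le _ _ _ _ Hl). intros n.
  change (Cmod (sum_n (G := C_AbelianMonoid) (gauss_term a (z * q ^ k) q) n - 1)
          <= M / (1 - Cmod z) * Cmod q ^ k)%R.
  assert (Hx : (0 <= Cmod q ^ k)%R) by apply pow_le, Cmod_ge_0.
  apply Rle_trans with (M * Cmod q ^ k * ((1 - Cmod z ^ S n) / (1 - Cmod z)))%R.
  - induction n as [|n IH].
    + rewrite sum_O. unfold gauss_term. simpl.
      replace (1 * 1 * 1 / (1 * 1) - 1) with (RtoC 0) by field.
      rewrite Cmod_0. apply Rmult_le_pos; [now apply Rmult_le_pos|].
      replace ((1 - Cmod z * 1) / (1 - Cmod z))%R with 1%R by (field; lra). lra.
    + rewrite sum_Sn. change plus with Cplus.
      set (s := sum_n (G := C_AbelianMonoid) (gauss_term a (z * q ^ k) q) n) in *.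
      set (t := gauss_term a (z * q ^ k) q (S n)).
      replace (s + t - 1) with (s - 1 + t) by ring.
      apply Rle_trans with (1 := Cmod_triangle _ _).
      replace (M * Cmod q ^ k * ((1 - Cmod z ^ S (S n)) / (1 - Cmod z)))%R
        with (M * Cmod q ^ k * ((1 - Cmod z ^ S n) / (1 - Cmod z))
              + M * (Cmod z ^ S n * Cmod q ^ k))%R by (simpl; field; lra).
      apply Rplus_le_compat; [exact IH|].
      apply Rle_trans with (1 := Hb k (S n)).
      apply Rmult_le_compat_l; [exact HM|]. rewrite Rpow_mult_distr.
      apply Rmult_le_compat_l; [apply pow_le, Cmod_ge_0|].
      assert (H1 : ((Cmod q ^ k) ^ n <= 1)%R).
      { rewrite <- (pow1 n). apply pow_incr. split; [exact Hx|].
        rewrite <- Cmod_pow. now apply Cmod_pow_le_1. }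
      simpl. nra.
  - replace (M / (1 - Cmod z) * Cmod q ^ k)%R
      with (M * Cmod q ^ k * (1 / (1 - Cmod z)))%R by (field; lra).
    apply Rmult_le_compat_l; [now apply Rmult_le_pos|].
    apply Rmult_le_compat_r; [apply Rlt_le, Rinv_0_lt_compat; lra|].
    generalize (pow_le (Cmod z) (S n) (Cmod_ge_0 z)). lra.
Qed.

(** After [k] uses of [gauss_series_shift], [(az;q)_k F(z) = (z;q)_k F(zq^k)]; then
    [k -> oo], where [F(zq^k)] tends to [1]. *)
Theorem q_gauss_limit a z q :
  (Cmod q < 1)%R -> (Cmod z < 1)%R -> (forall k, 1 - a * z * q ^ k <> 0) ->
  is_series (V := C_NormedModule) (gauss_term a z q)
    (qpoch_inf z q / qpoch_inf (a * z) q).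
Proof.
  intros Hq Hz Haz.
  destruct (gauss_series_converges a z q Hq Hz Haz) as [l Hl].
  assert (Hshift : forall k, exists l' : C,
    is_series (V := C_NormedModule) (gauss_term a (z * q ^ k) q) l' /\
    qpoch (a * z) q k * l = qpoch z q k * l').
  { induction k as [|k [l' [Hl' IH]]].
    - exists l. simpl. rewrite Cmult_1_r. split; [exact Hl | reflexivity].
    - assert (Haz' : forall m, 1 - a * (z * q ^ k) * q ^ m <> 0).
      { intros m. generalize (Haz (k + m)%nat). rewrite Cpow_add_r.
        now replace (a * z * (q ^ k * q ^ m)) with (a * (z * q ^ k) * q ^ m) by ring. }
      assert (Haz'' : forall m, 1 - a * (z * q ^ S k) * q ^ m <> 0).
      { intros m. generalize (Haz (S k + m)%nat). rewrite Cpow_add_r.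
        now replace (a * z * (q ^ S k * q ^ m)) with (a * (z * q ^ S k) * q ^ m) by ring. }
      assert (Hz' : (Cmod (z * q ^ S k) < 1)%R).
      { rewrite Cmod_mult. generalize (Cmod_pow_le_1 q (S k) Hq) (Cmod_ge_0 (q ^ S k)) (Cmod_ge_0 z).
        nra. }
      destruct (gauss_series_converges a _ q Hq Hz' Haz'') as [l'' Hl''].
      exists l''. split; [exact Hl''|].
      assert (E : (1 - a * (z * q ^ k)) * l' = (1 - z * q ^ k) * l'').
      { apply (gauss_series_shift a (z * q ^ k) q); try assumption.
        replace (z * q ^ k * q) with (z * q ^ S k) by (rewrite Cpow_S; ring). exact Hl''. }
      simpl. rewrite <- !Cmult_assoc, <- E.
      transitivity ((1 - a * z * q ^ k) * (qpoch (a * z) q k * l)); [ring|].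
      rewrite IH. ring. }
  destruct (gauss_series_near_1 a z q Hq Hz Haz) as [K HK].
  assert (E : qpoch_inf (a * z) q * l = qpoch_inf z q).
  { apply Clim_unique with (fun k => qpoch (a * z) q k * l).
    - apply Clim_mult; [now apply qpoch_inf_correct | apply Clim_const].
    - replace (qpoch_inf z q) with (qpoch_inf z q + 0) by ring.
      apply Clim_ext with (fun k => qpoch z q k + (qpoch (a * z) q k * l - qpoch z q k));
        [intros k; ring|].
      apply Clim_plus; [now apply qpoch_inf_correct|].
      apply Clim_squeeze with (fun k => (exp (Cmod z / (1 - Cmod q)) * K * Cmod q ^ k)%R).
      + intros k. destruct (Hshift k) as [l' [Hl' ->]].
        replace (qpoch z q k * l' - qpoch z q k - 0) with (qpoch z q k * (l' - 1)) by ring.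
        rewrite Cmod_mult, Rmult_assoc.
        apply Rmult_le_compat; try apply Cmod_ge_0; [now apply qpoch_upper | now apply HK].
      + apply is_lim_seq_scal_pow. split; [apply Cmod_ge_0 | exact Hq]. }
  replace (qpoch_inf z q / qpoch_inf (a * z) q) with l; [exact Hl|].
  rewrite <- E. field. now apply qpoch_inf_neq_0.
Qed.

(** * Gauss's product for the sum over triangular numbers *)

(** Partial sums of the q-binomial series [1phi0] with parameter [q] in base
    [q^2].  At [y = q^(2n+1)] they are the sums in Shanks's identity, where the
    quotient of products is usually called [1/P_s]. *)
Definition shanks_sum (q y : C) (m : nat) : C :=
  sum_n (G := C_AbelianMonoid)
    (fun s => qpoch q (q ^ 2) s / qpoch (q ^ 2) (q ^ 2) s * y ^ s) m.

Lemma shanks_sum_S q y m :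
  shanks_sum q y (S m)
  = shanks_sum q y m + qpoch q (q ^ 2) (S m) / qpoch (q ^ 2) (q ^ 2) (S m) * y ^ S m.
Proof. unfold shanks_sum. now rewrite sum_Sn. Qed.

(** The functional equation of the q-binomial series, with the boundary term of
    its partial sums. *)
Lemma shanks_sum_shift q y m :
  (Cmod q < 1)%R ->
  (1 - q * y) * shanks_sum q (q ^ 2 * y) m
  = (1 - y) * shanks_sum q y m
    + qpoch q (q ^ 2) (S m) / qpoch (q ^ 2) (q ^ 2) m * y ^ S m.
Proof.
  intros Hq. induction m as [|m IH].
  - unfold shanks_sum. rewrite !sum_O. simpl. field.
  - rewrite !shanks_sum_S, !Cmult_plus_distr_l, IH.
    assert (He := qpoch_even_neq_0 q m Hq).
    assert (Hw := qpoch_q_factor_neq_0 (q ^ 2) (Cmod_pow_2_lt_1 q Hq) m).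
    rewrite (qpoch_S q _ (S m)), !(qpoch_S _ _ m), (Cpow_mult_l (q ^ 2) y), !(Cpow_S _ m),
      (Cpow_S y (S m)), (Cpow_S y m).
    field. split; assumption.
Qed.

Definition triangular_sum (q : C) (n : nat) : C :=
  sum_n (G := C_AbelianMonoid) (fun s => q ^ (s * (s + 1) / 2)) n.

Lemma triangular_sum_S q n :
  triangular_sum q (S n) = triangular_sum q n + q ^ (S n * (S n + 1) / 2).
Proof. unfold triangular_sum. now rewrite sum_Sn. Qed.

(** By induction on [n]: multiplying by the next factor of [(q^2;q^2)] turns the
    sum at [q^2 y], for [y = q^(2n+3)], into the sum at [y] by [shanks_sum_shift].
    The boundary term and the new summand account for the two new triangular
    powers of [q]. *)
Lemma shanks_identity q n :
  (Cmod q < 1)%R ->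
  qpoch (q ^ 2) (q ^ 2) (S n) * shanks_sum q (q ^ S (2 * S n)) n
  = qpoch q (q ^ 2) (S n) * triangular_sum q (S (2 * n)).
Proof.
  intros Hq. induction n as [|n IH].
  - unfold shanks_sum, triangular_sum. rewrite sum_Sn, !sum_O. simpl.
    change plus with Cplus. field.
  - replace (2 * S n)%nat with (S (S (2 * n))) in * by lia.
    rewrite (triangular_sum_S q (S (S (2 * n)))), (triangular_sum_S q (S (2 * n))).
    replace (S (S (2 * n))) with (2 * S n)%nat in * by lia.
    rewrite (triangle_even (S n)), (triangle_odd (S n)).
    rewrite shanks_sum_S.
    set (y := q ^ S (2 * S n)) in *.
    replace (q ^ S (2 * S (S n))) with (q ^ 2 * y)
      by (unfold y; rewrite <- Cpow_add_r; f_equal; lia).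
    assert (He := qpoch_even_neq_0 q n Hq).
    assert (He1 := qpoch_even_neq_0 q (S n) Hq).
    assert (Hf : q ^ 2 * (q ^ 2) ^ S n = q * y).
    { unfold y. rewrite <- Cpow_S, <- Cpow_mult_r, <- Cpow_S. f_equal. lia. }
    assert (Hg : q * (q ^ 2) ^ S n = y).
    { unfold y. now rewrite <- Cpow_mult_r, <- Cpow_S. }
    rewrite (qpoch_S _ _ (S n)), (qpoch_S q _ (S n)), Hf, Hg.
    replace (q ^ (S n * S (2 * S n))) with (y ^ S n)
      by (unfold y; rewrite <- Cpow_mult_r; f_equal; lia).
    replace (q ^ (S (S n) * S (2 * S n))) with (y ^ S (S n))
      by (unfold y; rewrite <- Cpow_mult_r; f_equal; lia).
    assert (Hs := shanks_sum_shift q y n Hq).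
    set (e := qpoch (q ^ 2) (q ^ 2) n) in *.
    set (v := y ^ S n) in *. set (o := qpoch q (q ^ 2) (S n)) in *.
    rewrite (Cpow_mult_l (q ^ 2) y). fold v. rewrite (Cpow_S y (S n)). fold v.
    assert (He2 : qpoch (q ^ 2) (q ^ 2) (S n) = e * (1 - (q ^ 2) ^ S n)).
    { rewrite Cpow_S. reflexivity. }
    set (w := (q ^ 2) ^ S n) in *.
    transitivity (qpoch (q ^ 2) (q ^ 2) (S n) * ((1 - q * y) * shanks_sum q (q ^ 2 * y) n)
                  + (1 - q * y) * o * w * v).
    { field. exact He1. }
    rewrite Hs, Cmult_plus_distr_l.
    transitivity ((1 - y) * (qpoch (q ^ 2) (q ^ 2) (S n) * shanks_sum q y n)
                  + qpoch (q ^ 2) (q ^ 2) (S n) * (o / e * v)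
                  + (1 - q * y) * o * w * v); [ring|].
    rewrite IH, He2, <- Hg. field. exact He.
Qed.

(** The coefficients are bounded and [q^(2n+3)] tends to [0], so only the constant
    term survives. *)
Lemma shanks_sum_lim q :
  (Cmod q < 1)%R -> Clim (fun n => shanks_sum q (q ^ S (2 * S n)) n) 1.
Proof.
  intros Hq.
  assert (Hq2 := Cmod_pow_2_lt_1 q Hq).
  destruct (qpoch_lower (q ^ 2) (q ^ 2) Hq2 (qpoch_q_factor_neq_0 _ Hq2)) as [c [Hc Hlow]].
  assert (Hup := qpoch_upper q (q ^ 2) Hq2).
  set (B := exp (Cmod q / (1 - Cmod (q ^ 2)))) in *.
  assert (HB : (0 < B)%R) by apply exp_pos.
  assert (HK : (0 <= B / c)%R) by (apply Rlt_le, Rdiv_lt_0_compat; assumption).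
  assert (Hb : forall y m, (Cmod y < 1)%R ->
            (Cmod (shanks_sum q y m - 1) <= B / c * (Cmod y * ((1 - Cmod y ^ m) / (1 - Cmod y))))%R).
  { intros y m Hy. induction m as [|m IH].
    - unfold shanks_sum. rewrite sum_O. simpl.
      replace (1 / 1 * 1 - 1) with (RtoC 0) by field. rewrite Cmod_0.
      right. field. lra.
    - rewrite shanks_sum_S.
      set (t := qpoch q (q ^ 2) (S m) / qpoch (q ^ 2) (q ^ 2) (S m) * y ^ S m).
      replace (shanks_sum q y m + t - 1) with (shanks_sum q y m - 1 + t) by ring.
      apply Rle_trans with (1 := Cmod_triangle _ _).
      replace (B / c * (Cmod y * ((1 - Cmod y ^ S m) / (1 - Cmod y))))%R
        with (B / c * (Cmod y * ((1 - Cmod y ^ m) / (1 - Cmod y))) + B / c * Cmod y ^ S m)%R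
        by (simpl; field; lra).
      apply Rplus_le_compat; [exact IH|]. unfold t.
      rewrite Cmod_mult, Cmod_pow, Cmod_div by now apply qpoch_even_neq_0.
      apply Rmult_le_compat_r; [apply pow_le, Cmod_ge_0|].
      apply Rmult_le_compat; [apply Cmod_ge_0 | | apply Hup |].
      + apply Rlt_le, Rinv_0_lt_compat. now apply Cmod_gt_0, qpoch_even_neq_0.
      + now apply Rinv_le_contravar. }
  apply Clim_squeeze with (fun n => (B / c / (1 - Cmod q) * Cmod q ^ n)%R).
  - intros n. set (y := q ^ S (2 * S n)).
    assert (Hy : (Cmod y < 1)%R) by now apply Cmod_pow_S_lt_1.
    apply Rle_trans with (1 := Hb y n Hy).
    replace (B / c / (1 - Cmod q) * Cmod q ^ n)%R
      with (B / c * (Cmod q ^ n * / (1 - Cmod q)))%R by (field; lra).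
    apply Rmult_le_compat_l; [exact HK|].
    assert (Hyq : (Cmod y <= Cmod q ^ n)%R /\ (Cmod y <= Cmod q)%R).
    { unfold y. split.
      - replace (S (2 * S n)) with (n + S (S (S n)))%nat by lia.
        rewrite Cpow_add_r, Cmod_mult, Cmod_pow.
        generalize (Cmod_pow_le_1 q (S (S (S n))) Hq) (pow_le _ n (Cmod_ge_0 q)). nra.
      - rewrite Cpow_S, Cmod_mult.
        generalize (Cmod_pow_le_1 q (2 * S n) Hq) (Cmod_ge_0 q). nra. }
    destruct Hyq as [Hy1 Hy2].
    assert (Hp := pow_le _ n (Cmod_ge_0 y)).
    assert (Hp1 : (Cmod y ^ n <= 1)%R) by (rewrite <- Cmod_pow; now apply Cmod_pow_le_1).
    assert (Hi : (0 < / (1 - Cmod y))%R) by (apply Rinv_0_lt_compat; lra).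
    apply Rmult_le_compat; [apply Cmod_ge_0 | | exact Hy1 |].
    + apply Rmult_le_pos; lra.
    + apply Rle_trans with (/ (1 - Cmod y))%R.
      * unfold Rdiv. nra.
      * apply Rinv_le_contravar; lra.
  - apply is_lim_seq_scal_pow. split; [apply Cmod_ge_0 | exact Hq].
Qed.

Lemma Cmod_pow_triangle_le q n :
  (Cmod q < 1)%R -> (Cmod (q ^ (n * (n + 1) / 2)) <= Cmod q ^ n)%R.
Proof.
  intros Hq.
  assert (Hn : (n <= n * (n + 1) / 2)%nat) by (apply Nat.div_le_lower_bound; nia).
  replace (n * (n + 1) / 2)%nat with (n + (n * (n + 1) / 2 - n))%nat by lia.
  rewrite Cpow_add_r, Cmod_mult, Cmod_pow.
  generalize (Cmod_pow_le_1 q (n * (n + 1) / 2 - n) Hq) (pow_le _ n (Cmod_ge_0 q)). nra.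
Qed.

Lemma triangular_subseries_converges q (phi : nat -> nat) :
  (Cmod q < 1)%R -> (forall n, (n <= phi n)%nat) ->
  exists l : C,
    is_series (V := C_NormedModule) (fun n => q ^ (phi n * (phi n + 1) / 2)) l.
Proof.
  intros Hq Hphi.
  apply (ex_series_le (V := C_CompleteNormedModule)) with (b := fun n => (Cmod q ^ n)%R).
  - intros n. change norm with Cmod.
    apply Rle_trans with (1 := Cmod_pow_triangle_le q (phi n) Hq).
    replace (phi n) with (n + (phi n - n))%nat by (specialize (Hphi n); lia).
    rewrite pow_add, <- !Cmod_pow.
    generalize (Cmod_pow_le_1 q (phi n - n) Hq) (Cmod_ge_0 (q ^ n)). nra.
  - apply ex_series_geom. rewrite Rabs_pos_eq; [exact Hq | apply Cmod_ge_0].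
Qed.

Theorem gauss_triangular q :
  (Cmod q < 1)%R ->
  is_series (V := C_NormedModule) (fun s => q ^ (s * (s + 1) / 2))
    (qpoch_inf (q ^ 2) (q ^ 2) / qpoch_inf q (q ^ 2)).
Proof.
  intros Hq. assert (Hq2 := Cmod_pow_2_lt_1 q Hq).
  destruct (triangular_subseries_converges q (fun n => n) Hq (fun n => le_n n)) as [l Hl].
  assert (E : qpoch_inf (q ^ 2) (q ^ 2) * 1 = qpoch_inf q (q ^ 2) * l).
  { apply Clim_unique with
      (fun n => qpoch (q ^ 2) (q ^ 2) (S n) * shanks_sum q (q ^ S (2 * S n)) n).
    - apply Clim_mult; [|now apply shanks_sum_lim].
      apply (Clim_subseq _ _ S); [lia | now apply qpoch_inf_correct].
    - apply Clim_ext with (fun n => qpoch q (q ^ 2) (S n) * triangular_sum q (S (2 * n))).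
      { intros n. now rewrite shanks_identity. }
      apply Clim_mult.
      + apply (Clim_subseq _ _ S); [lia | now apply qpoch_inf_correct].
      + apply (Clim_subseq (triangular_sum q) l (fun n => S (2 * n))); [lia | exact Hl]. }
  replace (qpoch_inf (q ^ 2) (q ^ 2) / qpoch_inf q (q ^ 2)) with l; [exact Hl|].
  rewrite Cmult_1_r in E. rewrite E. field.
  now apply qpoch_inf_neq_0, qpoch_odd_factor_neq_0.
Qed.

(** * Theta functions as triangular sums *)

Lemma theta_unique a b (l : C) : is_bilateral_series (theta_term a b) l -> theta a b = l.
Proof.
  intros H. apply (iota_unique (V := C_CompleteNormedModule)); [|exact H].
  intros l' [m1 [m2 [H1 [H2 ->]]]]. destruct H as [n1 [n2 [H3 [H4 ->]]]].
  f_equal; eapply Clim_unique; eassumption.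
Qed.

Lemma theta_term_0 a b : theta_term a b (Z.of_nat 0) = 1.
Proof. unfold theta_term. simpl. ring. Qed.

Lemma theta_term_pos a b n :
  theta_term a b (Z.of_nat (S n)) = a ^ (S n * (S n + 1) / 2) * b ^ (n * (n + 1) / 2).
Proof.
  unfold theta_term.
  replace (Z.of_nat (S n) * (Z.of_nat (S n) + 1) / 2)%Z with (Z.of_nat (S n * (S n + 1) / 2)).
  2:{ rewrite Nat2Z.inj_div. f_equal. lia. }
  replace (Z.of_nat (S n) * (Z.of_nat (S n) - 1) / 2)%Z with (Z.of_nat (n * (n + 1) / 2)).
  2:{ rewrite Nat2Z.inj_div. f_equal. lia. }
  now rewrite !Nat2Z.id.
Qed.

Lemma theta_term_opp a b n : theta_term a b (- n) = theta_term b a n.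
Proof.
  unfold theta_term. rewrite Cmult_comm.
  replace (- n * (- n - 1))%Z with (n * (n + 1))%Z by ring.
  now replace (- n * (- n + 1))%Z with (n * (n - 1))%Z by ring.
Qed.

(** The indices [n+1] and [-n] give the same term, so each triangular number
    occurs twice. *)
Lemma theta_1 q (l : C) :
  is_series (V := C_NormedModule) (fun s => q ^ (s * (s + 1) / 2)) l ->
  theta 1 q = 2 * l.
Proof.
  intros Hl. apply theta_unique. exists (1 + l), (l - 1). repeat split; [ | | ring].
  - replace (1 + l) with (theta_term 1 q (Z.of_nat 0) + l) by now rewrite theta_term_0.
    apply (is_series_cons (fun n => theta_term 1 q (Z.of_nat n))).
    revert Hl. apply is_series_ext. intros n.
    now rewrite theta_term_pos, Cpow_1_l, Cmult_1_l.
  - apply is_series_ext with (fun n => q ^ (S n * (S n + 1) / 2)).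
    + intros n. now rewrite theta_term_opp, theta_term_pos, Cpow_1_l, Cmult_1_r.
    + exact (is_series_behead _ _ Hl).
Qed.

Lemma psi_term_pos q n :
  theta_term q (q ^ 3) (Z.of_nat (S n)) = q ^ (S (2 * n) * (S (2 * n) + 1) / 2).
Proof.
  rewrite theta_term_pos, <- Cpow_mult_r, <- Cpow_add_r. f_equal.
  rewrite triangle_even, triangle_S. generalize (triangle_double n). nia.
Qed.

Lemma psi_term_neg q n :
  theta_term q (q ^ 3) (- Z.of_nat (S n)) = q ^ (2 * S n * (2 * S n + 1) / 2).
Proof.
  rewrite theta_term_opp, theta_term_pos, <- Cpow_mult_r, <- Cpow_add_r. f_equal.
  rewrite triangle_odd, triangle_S. generalize (triangle_double n). nia.
Qed.

(** The exponent [2n^2 - n] is the triangular number of index [2n-1] for [n > 0]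
    and of index [-2n] for [n <= 0], so the terms of positive index carry the odd
    triangular indices and the others carry the even ones. *)
Lemma psi_triangular q (l : C) :
  (Cmod q < 1)%R ->
  is_series (V := C_NormedModule) (fun s => q ^ (s * (s + 1) / 2)) l ->
  psi q = l.
Proof.
  intros Hq Hl.
  destruct (triangular_subseries_converges q (fun n => S (2 * n)) Hq) as [l1 H1]; [lia|].
  destruct (triangular_subseries_converges q (fun n => (2 * S n)%nat) Hq) as [l2 H2]; [lia|].
  apply theta_unique. exists (1 + l1), l2.
  assert (H1' : is_series (V := C_NormedModule)
                  (fun n => theta_term q (q ^ 3) (Z.of_nat n)) (1 + l1)).
  { replace (1 + l1) with (theta_term q (q ^ 3) (Z.of_nat 0) + l1)
      by now rewrite theta_term_0.
    apply (is_series_cons (fun n => theta_term q (q ^ 3) (Z.of_nat n))).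
    revert H1. apply is_series_ext. intros n. now rewrite psi_term_pos. }
  assert (H2' : is_series (V := C_NormedModule)
                  (fun n => theta_term q (q ^ 3) (- Z.of_nat (S n))) l2).
  { revert H2. apply is_series_ext. intros n. now rewrite psi_term_neg. }
  repeat split; [exact H1' | exact H2' |].
  apply Clim_unique with (fun n => triangular_sum q (2 * S n)).
  - apply (Clim_subseq (triangular_sum q) l (fun n => (2 * S n)%nat)); [lia | exact Hl].
  - apply Clim_ext with (fun n =>
      sum_n (G := C_AbelianMonoid) (fun n => theta_term q (q ^ 3) (Z.of_nat n)) (S n)
      + sum_n (G := C_AbelianMonoid) (fun n => theta_term q (q ^ 3) (- Z.of_nat (S n))) n).
    + induction n as [|n IH].
      * rewrite sum_Sn, !sum_O, theta_term_0, psi_term_pos, (psi_term_neg q 0).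
        change plus with Cplus. change (2 * 1)%nat with 2%nat.
        rewrite !triangular_sum_S. unfold triangular_sum. rewrite sum_O. simpl. ring.
      * rewrite (sum_Sn _ (S n)), (sum_Sn (fun n => theta_term q (q ^ 3) (- Z.of_nat (S n))) n).
        change plus with Cplus.
        rewrite psi_term_pos, (psi_term_neg q (S n)).
        replace (2 * S (S n))%nat with (S (S (2 * S n))) by lia.
        rewrite (triangular_sum_S q (S (2 * S n))), (triangular_sum_S q (2 * S n)), <- IH.
        ring.
    + apply Clim_plus; [|exact H2'].
      apply (Clim_subseq _ _ S); [lia | exact H1'].
Qed.

Theorem gauss_psi q :
  (Cmod q < 1)%R -> psi q = qpoch_inf (q ^ 2) (q ^ 2) / qpoch_inf q (q ^ 2).
Proof. intros Hq. apply psi_triangular; [exact Hq | now apply gauss_triangular]. Qed.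

Theorem theta_1_product q :
  (Cmod q < 1)%R ->
  theta 1 q = 2 * (qpoch_inf (q ^ 2) (q ^ 2) / qpoch_inf q (q ^ 2)).
Proof. intros Hq. now apply theta_1, gauss_triangular. Qed.

(** * The two sides *)

(** [psi(q^2) / psi(-q)], as [f(1,q^2) = 2 psi(q^2)]. *)
Lemma theta_quotient q :
  (Cmod q < 1)%R ->
  theta 1 (q ^ 2) / (2 * psi (- q)) = qpoch_inf (- q ^ 2) (q ^ 2) / qpoch_inf q (q ^ 2).
Proof.
  intros Hq. assert (Hq2 := Cmod_pow_2_lt_1 q Hq).
  assert (Hq' : (Cmod (- q) < 1)%R) by now rewrite Cmod_opp.
  rewrite theta_1_product, gauss_psi by assumption.
  assert (E : (- q) ^ 2 = q ^ 2) by (simpl; ring). rewrite E.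
  rewrite <- (qpoch_inf_mult_opp (q ^ 2) (q ^ 2)), <- (qpoch_inf_mult_opp q (q ^ 2)) by assumption.
  assert (H1 := qpoch_inf_neq_0 q (q ^ 2) Hq2 (qpoch_odd_factor_neq_0 q Hq)).
  assert (H2 : qpoch_inf (- q) (q ^ 2) <> 0).
  { apply qpoch_inf_neq_0; [exact Hq2|]. rewrite <- E. now apply qpoch_odd_factor_neq_0. }
  assert (H3 : qpoch_inf (q ^ 2) (q ^ 2) <> 0)
    by now apply qpoch_inf_neq_0, qpoch_q_factor_neq_0.
  field. repeat split; assumption.
Qed.

Lemma main_summand q n :
  (Cmod q < 1)%R ->
  q ^ (n * (n + 1)) * qpoch (- q) (q ^ 2) n / qpoch q q (2 * n + 1)
  = / (1 - q) * gauss_term (- q) (- q ^ 2) (q ^ 2) n.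
Proof.
  intros Hq. unfold gauss_term.
  assert (Hodd := qpoch_odd_factor_neq_0 q Hq).
  assert (H1 : 1 - q <> 0) by now apply one_minus_neq_0.
  assert (Hden : qpoch q q (2 * n + 1)
                 = (1 - q) * qpoch (- q * - q ^ 2) (q ^ 2) n * qpoch (q ^ 2) (q ^ 2) n).
  { replace (- q * - q ^ 2) with (q * q ^ 2) by ring.
    rewrite <- qpoch_S_l, Nat.add_1_r, !qpoch_S, qpoch_even_odd, Cpow_mult_r. ring. }
  assert (Hnum : q ^ (n * (n + 1)) = (- - q ^ 2) ^ n * (q ^ 2) ^ (n * (n - 1) / 2)).
  { replace (- - q ^ 2) with (q ^ 2) by ring.
    rewrite <- Cpow_add_r, <- Cpow_mult_r, <- triangle_double.
    rewrite (Nat.add_comm n (n * _ / _)), <- choose_two_S.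
    replace (S n * (S n - 1))%nat with (n * (n + 1))%nat by lia. reflexivity. }
  rewrite Hden, Hnum.
  assert (H2 := qpoch_even_neq_0 q n Hq).
  assert (H3 : qpoch (- q * - q ^ 2) (q ^ 2) n <> 0).
  { intros E. apply (qpoch_neq_0 q (q ^ 2) (S n) Hodd). rewrite qpoch_S_l.
    replace (q * q ^ 2) with (- q * - q ^ 2) by ring. rewrite E. ring. }
  field. repeat split; assumption.
Qed.

Theorem mainTheorem2 (q : C) (hq : (Cmod q < 1)%R) :
  is_series (V := C_NormedModule)
    (fun n : nat =>
       q ^ (n * (n + 1)) * qpoch (- q) (q ^ 2) n / qpoch q q (2 * n + 1))
    (theta 1 (q ^ 2) / (2 * psi (- q)))
  /\ theta 1 (q ^ 2) / (2 * psi (- q))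
     = qpoch_inf (- q) q * qpoch_inf (- q ^ 2) (q ^ 2).
Proof.
  assert (Hq2 := Cmod_pow_2_lt_1 q hq).
  assert (Hodd := qpoch_odd_factor_neq_0 q hq).
  rewrite theta_quotient by exact hq. split.
  - assert (Hz : (Cmod (- q ^ 2) < 1)%R) by now rewrite Cmod_opp.
    assert (Haz : forall k, 1 - - q * - q ^ 2 * (q ^ 2) ^ k <> 0).
    { intros k. generalize (Hodd (S k)). rewrite Cpow_S.
      now replace (q * (q ^ 2 * (q ^ 2) ^ k)) with (- q * - q ^ 2 * (q ^ 2) ^ k) by ring. }
    assert (Hs := is_series_scal (V := C_NormedModule) (/ (1 - q)) _ _
                    (q_gauss_limit _ _ _ Hq2 Hz Haz)).
    replace (qpoch_inf (- q ^ 2) (q ^ 2) / qpoch_inf q (q ^ 2))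
      with (/ (1 - q) * (qpoch_inf (- q ^ 2) (q ^ 2) / qpoch_inf (- q * - q ^ 2) (q ^ 2))).
    + revert Hs. apply is_series_ext. intros n. now rewrite main_summand.
    + rewrite (qpoch_inf_S_l q) by exact Hq2.
      replace (q * q ^ 2) with (- q * - q ^ 2) by ring.
      field. split; [now apply qpoch_inf_neq_0 | now apply one_minus_neq_0].
  - rewrite <- (Cmult_1_l (qpoch_inf (- q ^ 2) (q ^ 2) / qpoch_inf q (q ^ 2))).
    rewrite <- (euler_odd_distinct q hq). field. now apply qpoch_inf_neq_0.
Qed.
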